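(* Let $G$ be a connected graph and $H=\mathcal{H}(G)$ its injective hull, with $G$ regarded as an isometric subgraph of $H$. For any $x,y,z\in V(G)$ and integer $k\ge 0$, the disk $D_G(z,k)$ separates $x$ and $y$ in $G$ if and only if the disk $D_H(z,k)$ separates $x$ and $y$ in $H$.
   Context: Graphs are finite, connected, simple, with shortest-path metric $d$. $D_G(z,k)=\{u\in V(G): d_G(u,z)\le k\}$. A set $M$ separates vertices $x,y$ if removing $M$ from the graph places $x$ and $y$ in distinct connected components. A graph is Helly if every family of pairwise intersecting disks has a common vertex. The injective hull $\mathcal{H}(G)$ is the unique minimal Helly graph containing $G$ as an isometric subgraph; concretely its vertices are the functions $f:V(G)\to\mathbb{Z}_{\ge0}$ with $f(x)+f(y)\ge d_G(x,y)$ for all $x,y$ and for each $x$ some $y$ with equality, two functions adjacent iff $\max_x|f(x)-g(x)|=1$, and $G$ embeds via $z\mapsto d_G(z,\cdot)$. *)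

(* Defs.v *)
From HB Require Import structures.
From mathcomp Require Import all_boot ssrint.

Set Implicit Arguments.
Unset Strict Implicit.
Unset Printing Implicit Defensive.

Record sgraph := SGraph {
  vertex :> finType;
  adj : rel vertex;
  adj_sym : symmetric adj;
  adj_irr : irreflexive adj
}.

Definition connected_graph (G : sgraph) := forall x y : G, connect (@adj G) x y.

Section Distance.
Variable G : sgraph.
Implicit Types (x y z : G) (M : {set G}).

Definition walk n x y :=
  [exists p : n.-tuple G, path (@adj G) x p && (last x p == y)].

(* The least length of a walk from x to y. Shortest walks have fewer than #|G|
   edges, so #|G| is returned exactly when there is no walk (dist_lt_card). *)
Definition dist x y : nat := find (fun n => walk n x y) (iota 0 #|G|).

Definition disk z k : {set G} := [set u | dist u z <= k].

(* x and y must survive the removal of M: a vertex of M lies in no component of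
   G - M. *)
Definition separates M x y : bool :=
  [&& x \notin M, y \notin M &
      ~~ connect [rel u v | [&& u \notin M, v \notin M & adj u v]] x y].

Lemma walkP n x y :
  reflect (exists p, [/\ size p = n, path (@adj G) x p & last x p = y])
          (walk n x y).
Proof.
apply: (iffP existsP) => [[p /andP[xp /eqP py]] | [p [sp xp py]]].
  by exists p; rewrite size_tuple.
by exists (tcast sp (in_tuple p)); rewrite val_tcast /= xp py eqxx.
Qed.

Lemma dist_max x y : dist x y <= #|G|.
Proof. by rewrite -[leqRHS](size_iota 0) find_size. Qed.

Lemma dist_walk x y : dist x y < #|G| -> walk (dist x y) x y.
Proof.
rewrite /dist -[X in _ < X -> _](size_iota 0) -has_find => h.
have := nth_find 0 h; rewrite nth_iota ?add0n //.
by rewrite -[X in _ < X](size_iota 0) -has_find.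
Qed.

Lemma dist_le n x y : walk n x y -> dist x y <= n.
Proof.
move=> w; case: (leqP #|G| n) => [|lt_n]; first exact/leq_trans/dist_max.
rewrite leqNgt; apply/negP => /(before_find 0).
by rewrite nth_iota // add0n w.
Qed.

Lemma dist_lt_card x y : (dist x y < #|G|) = connect (@adj G) x y.
Proof.
apply/idP/connectP => [/dist_walk/walkP[p [_ xp py]] | [p xp ->]].
  by exists p.
case/shortenP: xp => q xq uq _.
apply: leq_ltn_trans (dist_le (n := size q) _) _; first by apply/walkP; exists q.
by rewrite -[_ < _]/(size (x :: q) <= _) -(card_uniqP uq) max_card.
Qed.

Lemma distxx x : dist x x = 0.
Proof. by apply/eqP; rewrite -leqn0; apply/dist_le/walkP; exists [::]. Qed.

Lemma walk_sym n x y : walk n x y -> walk n y x.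
Proof.
case/walkP=> p [sp xp <-]; apply/walkP; exists (rev (belast x p)).
rewrite size_rev size_belast rev_path; split=> //.
  by rewrite (eq_path (e' := @adj G)) // => u v; rewrite /= adj_sym.
by case: p {sp xp} => //= u p; rewrite rev_cons last_rcons.
Qed.

Lemma dist_sym x y : dist x y = dist y x.
Proof.
suff le u v : dist u v <= dist v u by apply/eqP; rewrite eqn_leq !le.
case: (ltnP (dist v u) #|G|) => [/dist_walk/walk_sym/dist_le // |].
exact/leq_trans/dist_max.
Qed.

Lemma dist_triangle x y z : dist x z <= dist x y + dist y z.
Proof.
case: (ltnP (dist x y) #|G|) => [/dist_walk/walkP[p [sp xp py]] | le1]; last first.
  by apply: leq_trans (dist_max x z) (leq_trans le1 (leq_addr _ _)).
case: (ltnP (dist y z) #|G|) => [/dist_walk/walkP[q [sq yq qz]] | le1]; last first.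
  by apply: leq_trans (dist_max x z) (leq_trans le1 (leq_addl _ _)).
apply/dist_le/walkP; exists (p ++ q).
by rewrite size_cat cat_path last_cat sp sq py xp.
Qed.

End Distance.

Arguments dist {G}.
Arguments disk {G}.
Arguments separates {G}.

Section Hull.
Variable G : sgraph.

Definition extremal (f : {ffun G -> nat}) : bool :=
  [forall x, forall y, dist x y <= f x + f y] &&
  [forall x, exists y, f x + f y == dist x y].

Record hull_vertex := HullVertex {
  hull_fun :> {ffun G -> nat};
  hull_extremal : extremal hull_fun
}.

HB.instance Definition _ := [isSub for hull_fun].
HB.instance Definition _ := [Countable of hull_vertex by <:].

Lemma hull_bound (f : hull_vertex) x : f x < #|G|.+1.
Proof.
case/andP: (hull_extremal f) => _ /forallP/(_ x)/existsP[y /eqP fxy].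
by rewrite ltnS (leq_trans _ (dist_max x y)) // -fxy leq_addr.
Qed.

(* Extremal functions are bounded, hence form a finite type. *)
Definition hull_encode (f : hull_vertex) : {ffun G -> 'I_#|G|.+1} :=
  [ffun x => Ordinal (hull_bound f x)].
Definition hull_decode (g : {ffun G -> 'I_#|G|.+1}) : option hull_vertex :=
  insub [ffun x => val (g x)].

Lemma hull_encodeK : pcancel hull_encode hull_decode.
Proof.
move=> f; rewrite /hull_decode.
have -> : [ffun x => val (hull_encode f x)] = val f.
  by apply/ffunP=> x; rewrite !ffunE.
by rewrite valK.
Qed.

HB.instance Definition _ : isFinite hull_vertex := PCanIsFinite hull_encodeK.

Definition hull_adj : rel hull_vertex :=
  [rel f g : hull_vertex | \max_(x : G) `|f x - g x|%N == 1].

Lemma hull_adj_sym : symmetric hull_adj.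
Proof.
move=> f g; rewrite /hull_adj /=; congr (_ == 1).
by apply: eq_bigr => x _; rewrite distnC.
Qed.

Lemma hull_adj_irr : irreflexive hull_adj.
Proof. by move=> f; rewrite /hull_adj /= big1 // => x _; rewrite distnn. Qed.

Definition hull : sgraph := SGraph hull_adj_sym hull_adj_irr.

Lemma extremal_dist (z : G) : extremal [ffun u => dist z u].
Proof.
apply/andP; split; apply/forallP=> x.
  by apply/forallP=> y; rewrite !ffunE (dist_sym z x) dist_triangle.
by apply/existsP; exists z; rewrite !ffunE distxx addn0 dist_sym.
Qed.

Definition hull_embed (z : G) : hull := HullVertex (extremal_dist z).

End Hull.

Arguments hull_embed {G}.

(* Main.v *)
(** Each hull vertex [f] at distance more than [k] from [z] has a witness: a
    vertex [u] of [G] with [f z + f u = d(z, u)], hence outside the disk.  If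
    [u] and [v] lie outside the disk in different components of its complement,
    then a shortest path from [u] to [v] meets the disk, so that
    [d(z, u) + d(z, v) <= d(u, v) + 2 k].  Since [d(u, v) <= f u + f v], the
    witnesses of equal or adjacent hull vertices all lie in one component, and a
    path of the hull avoiding the disk projects to a component of [G]. *)
Require Import Defs.
From mathcomp Require Import all_boot ssrint zify.

Set Implicit Arguments.
Unset Strict Implicit.
Unset Printing Implicit Defensive.

Definition outside (G : sgraph) (M : {set G}) : rel G :=
  [rel u v | [&& u \notin M, v \notin M & adj u v]].

Section GraphDistance.
Variable G : sgraph.
Hypothesis connG : connected_graph G.
Implicit Types (x y z u v w : G) (M : {set G}).

Lemma dist_eq0 x y : dist x y = 0 -> x = y.
Proof.
move=> d0; have : dist x y < #|G| by rewrite dist_lt_card connG.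
by move=> /dist_walk/walkP[[|u p] []]; rewrite d0.
Qed.

Lemma dist_adj x y : adj x y -> dist x y = 1.
Proof.
move=> xy; have le1 : dist x y <= 1.
  by apply/dist_le/walkP; exists [:: y]; rewrite /= xy.
case E: (dist x y) le1 => [|[|n]] // _.
by move: xy; rewrite (dist_eq0 E) adj_irr.
Qed.

(** A shortest walk from [u] to [v] that avoided [M] would connect them outside [M]. So it splits at
    some [w] in [M] into two walks whose lengths add up to [dist u v]. *)
Lemma dist_through_separator M u v :
    u \notin M -> ~~ connect (outside M) u v ->
  exists2 w, w \in M & dist u w + dist w v <= dist u v.
Proof.
move=> uM nuv; have : dist u v < #|G| by rewrite dist_lt_card connG.
move=> /dist_walk/walkP[p [<- up pv]].
have [/hasP[w wp wM] | noM] := boolP (has [in M] p).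
  exists w => //; move: wp up pv.
  case/splitPr => p1 p2; rewrite cat_path /= last_cat /= => /and3P[up1 p1w wp2] pv.
  rewrite -cat_rcons size_cat leq_add //; apply/dist_le/walkP.
    by exists (rcons p1 w); rewrite rcons_path last_rcons up1.
  by exists p2.
case/negP: nuv; apply/connectP; exists p => //.
elim: p u uM up noM {pv} => //= a p IHp u uM /andP[ua ap].
rewrite negb_or => /andP[aM pM].
by rewrite IHp // andbT /outside /= uM aM.
Qed.

Lemma dist_disk_separated z k u v :
    u \notin disk z k -> ~~ connect (outside (disk z k)) u v ->
  dist z u + dist z v <= dist u v + k.*2.
Proof.
move=> uD /(dist_through_separator uD)[w]; rewrite inE => wz.
have := dist_triangle z w u; have := dist_triangle z w v.
by rewrite (dist_sym w u) (dist_sym z w); lia.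
Qed.

(** Induction on the sum of the values: as long as some [x] has no tight partner, the value at [x]
    can drop by one without breaking the distance bound. *)
Lemma extremal_below (h : {ffun G -> nat}) :
    (forall x y, dist x y <= h x + h y) ->
  exists2 g : {ffun G -> nat}, extremal g & forall x, g x <= h x.
Proof.
have [n] := ubnP (\sum_x h x); elim: n h => // n IHn h le_n dh.
have [ext|] := boolP [forall x, exists y, h x + h y == dist x y].
  exists h => //; apply/andP; split=> //.
  by apply/forallP => x; apply/forallP => y.
rewrite negb_forall => /existsP[x /existsPn slack].
have ltx y : dist x y < h x + h y by rewrite ltn_neqAle eq_sym slack dh.
(* The slack of the pair [x, x] makes [h x] positive, so its predecessor is a true decrease. *)
have hx : 0 < h x by have := ltx x; rewrite distxx; lia.
pose h' : {ffun G -> nat} := [ffun y => if y == x then (h x).-1 else h y].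
have h'h y : h' y <= h y by rewrite ffunE; case: eqP => [->|//]; lia.
case: (IHn h') => [||g extg gh'].
- rewrite ltnS in le_n; apply: leq_trans le_n; rewrite (bigD1 x) // [leqRHS](bigD1 x) //=.
  rewrite ffunE eqxx -addSn prednK // leq_add2l.
  by apply: leq_sum => y _.
- move=> a b; rewrite !ffunE.
  case: eqP => [->|_]; case: eqP => [->|_].
  + by rewrite distxx.
  + by have := ltx b; lia.
  + by have := ltx a; rewrite dist_sym; lia.
  + exact: dh.
by exists g => // y; apply: leq_trans (gh' y) (h'h y).
Qed.

End GraphDistance.

Section HullDistance.
Variable G : sgraph.
Hypothesis connG : connected_graph G.
Implicit Types (x y z u v w : G) (f g : hull G).

Lemma hull_dist f x y : dist x y <= f x + f y.
Proof.
by case/andP: (hull_extremal f) => /forallP/(_ x)/forallP/(_ y).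
Qed.

Lemma hull_witness f x : exists y, f x + f y = dist x y.
Proof.
case/andP: (hull_extremal f) => _ /forallP/(_ x)/existsP[y /eqP fxy].
by exists y.
Qed.

Lemma hull_adjP f g :
  reflect ((forall x, f x <= (g x).+1 /\ g x <= (f x).+1) /\
           exists x, f x != g x)
          (adj f g).
Proof.
rewrite /= /hull_adj /=; apply: (iffP eqP) => [max1 | [close [x neq]]].
  split=> [x|].
    have : `|f x - g x|%N <= 1 by rewrite -max1 leq_bigmax.
    by lia.
  apply/existsP; rewrite -negb_forall; apply/negP => /forallP eqfg.
  by move: max1; rewrite big1 // => x _; rewrite (eqP (eqfg x)) distnn.
apply/eqP; rewrite eqn_leq; apply/andP; split.
  by apply/bigmax_leqP => y _; have := close y; lia.
by apply: leq_trans (leq_bigmax x); lia.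
Qed.

Lemma hull_embedE z u : hull_embed z u = dist z u.
Proof. by rewrite ffunE. Qed.

Lemma hull_embed_adj u v : adj u v -> adj (hull_embed u) (hull_embed v).
Proof.
move=> uv; have duv := dist_adj connG uv; apply/hull_adjP; split=> [x|].
  rewrite !hull_embedE; have := dist_triangle u v x.
  by have := dist_triangle v u x; rewrite (dist_sym v u); lia.
by exists v; rewrite !hull_embedE distxx duv.
Qed.

(** The distance bound at [z] and [u] gives [d(z, u) <= f u]. Conversely, a tight partner [y] of [u]
    gives [f u = d(u, y) - f y <= d(u, y) - d(z, y) <= d(u, z)]. *)
Lemma hull_zero f z : f z = 0 -> f = hull_embed z.
Proof.
move=> fz; apply/val_inj/ffunP => u; rewrite ffunE -[LHS]/(f u).
have [y fuy] := hull_witness f u.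
have := dist_triangle u z y; have := hull_dist f z u.
by have := hull_dist f z y; rewrite (dist_sym u z) -fuy fz; lia.
Qed.

(* Lower [f] by one at [z], raise it by one elsewhere, and take an extremal
   function below the result. *)
Lemma hull_step f z n : f z = n.+1 -> exists2 g, adj f g & g z = n.
Proof.
move=> fz; pose h : {ffun G -> nat} := [ffun u => if u == z then n else (f u).+1].
have [a b|g extg gh] := extremal_below (h := h).
  rewrite !ffunE; have := hull_dist f a b.
  case: eqP => [->|_]; case: eqP => [->|_]; rewrite ?distxx ?fz; lia.
have close x : f x <= (g x).+1 /\ g x <= (f x).+1.
  have gf u : g u <= (f u).+1.
    by apply: leq_trans (gh u) _; rewrite ffunE; case: eqP => [->|//]; lia.
  (* Minimality of [f] bounds [g] from below: if [y] is tight for [x], then [f x + f y = d(x, y) <=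
     g x + g y <= g x + f y + 1]. *)
  split=> //; have [y fxy] := hull_witness f x.
  by have := hull_dist (HullVertex extg) x y; have := gf y; rewrite /= -fxy; lia.
have gz : g z = n.
  by have := close z; have := gh z; rewrite ffunE eqxx fz; lia.
exists (HullVertex extg) => //; apply/hull_adjP; split=> //.
by exists z; rewrite fz /= gz; lia.
Qed.

Lemma hull_walk f z : walk (f z) f (hull_embed z).
Proof.
move fz: (f z) => n; elim: n f fz => [|n IHn] f fz.
  by apply/walkP; exists [::]; rewrite /= (hull_zero fz).
have [g fg gz] := hull_step fz.
have /walkP[p [sp gp pz]] := IHn g gz.
by apply/walkP; exists (g :: p); split; [rewrite /= sp | apply/andP |].
Qed.

Lemma hull_path_lipschitz f p z :
  path (@adj (hull G)) f p -> f z <= size p + last f p z.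
Proof.
elim: p f => //= g p IHp f /andP[/hull_adjP[/(_ z)[fg _] _] /IHp].
by lia.
Qed.

(** Descending one unit at a time reaches the embedded [z] in [f z] steps, and no walk is shorter
    because an edge changes the value at [z] by at most one. Disks of the hull around embedded
    vertices thus become conditions on values. *)
Lemma dist_hull_embed f z : dist f (hull_embed z) = f z.
Proof.
have le_d := dist_le (hull_walk f z); apply/eqP; rewrite eqn_leq le_d /=.
(* Only below this default value is [dist] known to be the length of an actual walk. *)
have : dist f (hull_embed z) < #|hull G|.
  rewrite dist_lt_card; have /walkP[p [_ fp <-]] := hull_walk f z.
  by apply/connectP; exists p.
move=> /dist_walk/walkP[p [<- fp pz]].
by have := hull_path_lipschitz z fp; rewrite pz hull_embedE distxx addn0.
Qed.

Lemma hull_diskE f z k : (f \in disk (hull_embed z) k) = (f z <= k).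
Proof. by rewrite inE dist_hull_embed. Qed.

Lemma hull_embed_disk x z k :
  (hull_embed x \in disk (hull_embed z) k) = (x \in disk z k).
Proof. by rewrite hull_diskE hull_embedE inE. Qed.

Lemma hull_embed_connect x y z k :
    connect (outside (disk z k)) x y ->
  connect (outside (disk (hull_embed z) k)) (hull_embed x) (hull_embed y).
Proof.
case/connectP=> p xp ->; elim: p x xp => //= u p IHp x.
case/andP=> /and3P[xD uD xu] /IHp; apply/connect_trans/connect1.
by rewrite /outside /= !hull_embed_disk xD uD; apply: hull_embed_adj.
Qed.

(** If [u] and [v] were separated, [f z + f u + g z + g v <= d(u, v) + 2 k <= f u + g v + 1 + 2 k],
    whereas [f z + g z >= 2 k + 2]. The one-sided bound on [f] covers both [f = g] and adjacency. *)
Lemma hull_witness_connect f g z k u v :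
    k < f z -> k < g z -> (forall w, f w <= (g w).+1) ->
    f z + f u = dist z u -> g z + g v = dist z v ->
  connect (outside (disk z k)) u v.
Proof.
move=> fk gk fg fu gv.
have uD : u \notin disk z k by rewrite inE dist_sym -fu; lia.
apply/negPn/negP => /(dist_disk_separated connG uD).
by have := hull_dist f u v; have := fg v; lia.
Qed.

Lemma hull_connect_witness f g z k u v :
    connect (outside (disk (hull_embed z) k)) f g -> k < f z ->
    f z + f u = dist z u -> g z + g v = dist z v ->
  connect (outside (disk z k)) u v.
Proof.
case/connectP=> p; elim: p f u => [|h p IHp] f u /=.
  (* Here [f = g], but [u] and [v] may be different witnesses of it. *)
  by move=> _ -> fk; apply: hull_witness_connect.
case/andP=> /and3P[_]; rewrite hull_diskE -ltnNge => hk.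
move=> /hull_adjP[close _] hp lp fk fu gv.
have [w hw] := hull_witness h z.
apply: connect_trans (IHp h w hp lp hk hw gv).
by apply: hull_witness_connect fu hw => // a; case: (close a).
Qed.

Lemma hull_connect_outside x y z k :
    x \notin disk z k ->
  connect (outside (disk (hull_embed z) k)) (hull_embed x) (hull_embed y) =
  connect (outside (disk z k)) x y.
Proof.
move=> xD; apply/idP/idP; last exact: hull_embed_connect.
(* Each vertex of [G] is a witness of its own embedding, so the projected component contains [x] and
   [y] themselves. *)
have embed_witness u : hull_embed u z + hull_embed u u = dist z u.
  by rewrite !hull_embedE distxx addn0 dist_sym.
move/hull_connect_witness; apply=> //.
by rewrite hull_embedE; rewrite inE -ltnNge in xD.
Qed.

End HullDistance.

Theorem theorem1 (G : sgraph) (hG : connected_graph G) (x y z : G) (k : nat) :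
  separates (disk z k) x y <->
  separates (disk (hull_embed z) k) (hull_embed x) (hull_embed y).
Proof.
rewrite /separates !hull_embed_disk.
have [xD|xD] := boolP (x \in disk z k); first by [].
by rewrite /= -!/(outside _) hull_connect_outside.
Qed.
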